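(* Let $\mathcal{P}_N\subset[0,1)^d$, $N=2^m$, be a digital net in base $2$ with generating matrices $C_1,\dots,C_d$, let $p\ge1$, let $c_0,\dots,c_{2^p-1}\in[0,1]$, let $\phi_p:[0,1]\to[0,1]$ be an order-preserving map with $\phi_p(a/2^p)=c_a$ for $0\le a<2^p$, let $f:[0,1]^d\to\mathbb{R}$ be integrable, and put $F_p(\boldsymbol{x})=f(\phi_p(x_1),\dots,\phi_p(x_d))$. Assume that the Walsh expansion of $F_p$ can be summed termwise at the resolution-$p$ grid points. Then $$Q_{N,p}(f)=\sum_{\substack{\boldsymbol{k}\in\mathbb{N}_0^d\\ \boldsymbol{k}^{(0)}\in\mathcal{D}_{N,p}^{\perp}}}\widehat{F_p}(\boldsymbol{k}),\qquad Q_p^{\mathrm{prod}}(f)=\sum_{\substack{\boldsymbol{k}\in\mathbb{N}_0^d\\ \boldsymbol{k}^{(0)}=\boldsymbol{0}}}\widehat{F_p}(\boldsymbol{k}).$$ Consequently, $$Q_{N,p}(f)-I(f)=\bigl(Q_p^{\mathrm{prod}}(f)-I(f)\bigr)+\sum_{\substack{\boldsymbol{k}\in\mathbb{N}_0^d\\ \boldsymbol{k}^{(0)}\in\mathcal{D}_{N,p}^{\perp}\setminus\{\boldsymbol{0}\}}}\widehat{F_p}(\boldsymbol{k}).$$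
   Context: Digital net in base $2$: generating matrices $C_1,\dots,C_d\in\mathbb{F}_2^{\mathbb{N}\times m}$ (infinitely many rows, $m$ columns) are given. For $0\le n<N=2^m$ with $n=n_0+2n_1+\cdots+2^{m-1}n_{m-1}$, $n_i\in\{0,1\}$, let $\vec n=(n_0,\dots,n_{m-1})^\top\in\mathbb{F}_2^m$, $\vec y_{n,j}=C_j\vec n=(y_{n,j,1},y_{n,j,2},\dots)^\top\in\mathbb{F}_2^{\mathbb{N}}$ and $x_{n,j}=\sum_{r\ge1}y_{n,j,r}2^{-r}$; the points are $\boldsymbol{x}_n=(x_{n,1},\dots,x_{n,d})\in[0,1)^d$ (as a multiset). It is assumed that no digit sequence $\vec y_{n,j}$ is eventually constantly $1$, so that $(y_{n,j,r})_r$ are the standard binary digits of $x_{n,j}$. Rules: for $x\in[0,1)$, $I_p(x)=\lfloor2^px\rfloor$ and $T_p(x)=c_{I_p(x)}$; $T_p$ acts coordinate-wise on $[0,1)^d$. Then $Q_{N,p}(f)=\frac1N\sum_{n=0}^{N-1}f(T_p(\boldsymbol{x}_n))$, $Q_p^{\mathrm{prod}}(f)=2^{-pd}\sum_{\boldsymbol{a}\in\{0,\dots,2^p-1\}^d}f(c_{a_1},\dots,c_{a_d})$, $I(f)=\int_{[0,1]^d}f(\boldsymbol{x})\,d\boldsymbol{x}$. Walsh functions: for $k=\sum_{i\ge0}\kappa_i2^i\in\mathbb{N}_0$ and $x=\sum_{r\ge1}\xi_r2^{-r}\in[0,1)$ (standard binary expansions, digits of $x$ not eventually all $1$), $\operatorname{wal}_k(x)=(-1)^{\sum_{i\ge0}\kappa_i\xi_{i+1}}$;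 for $\boldsymbol{k}\in\mathbb{N}_0^d$, $\operatorname{wal}_{\boldsymbol{k}}(\boldsymbol{x})=\prod_{j=1}^d\operatorname{wal}_{k_j}(x_j)$. $F_p$ is assumed integrable, and $\widehat{F_p}(\boldsymbol{k})=\int_{[0,1]^d}F_p(\boldsymbol{x})\operatorname{wal}_{\boldsymbol{k}}(\boldsymbol{x})\,d\boldsymbol{x}$. Termwise summability: the resolution-$p$ grid points are $\boldsymbol{a}/2^p$, $\boldsymbol{a}\in\{0,\dots,2^p-1\}^d$. The assumption means that, for a fixed increasing sequence of finite sets $K_1\subset K_2\subset\cdots$ with union $\mathbb{N}_0^d$, $\sum_{\boldsymbol{k}\in K_s}\widehat{F_p}(\boldsymbol{k})\operatorname{wal}_{\boldsymbol{k}}(\boldsymbol{x})\to F_p(\boldsymbol{x})$ as $s\to\infty$ at every resolution-$p$ grid point $\boldsymbol{x}$; all infinite sums over a subset $S\subseteq\mathbb{N}_0^d$ are understood as limits of the sums over $S\cap K_s$. Retained/tail split: each $\boldsymbol{k}\in\mathbb{N}_0^d$ is written uniquely as $\boldsymbol{k}=\boldsymbol{k}^{(0)}+2^p\boldsymbol{k}^{(1)}$ with $\boldsymbol{k}^{(0)}\in\{0,\dots,2^p-1\}^d$ and $\boldsymbol{k}^{(1)}\in\mathbb{N}_0^d$. Let $C_{j,p}\in\mathbb{F}_2^{p\times m}$ be the first $p$ rows of $C_j$, and for $h=\sum_{i=0}^{p-1}\eta_i2^i$ let $\vec h=(\eta_0,\dots,\eta_{p-1})^\top\in\mathbb{F}_2^p$.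 The retained dual-character set is $$\mathcal{D}_{N,p}^{\perp}=\bigl\{\boldsymbol{h}\in\{0,\dots,2^p-1\}^d:\ C_{1,p}^\top\vec h_1+\cdots+C_{d,p}^\top\vec h_d=0\ \text{in }\mathbb{F}_2^m\bigr\}.$$ *)

(* Defs.v *)
From HB Require Import structures.
From mathcomp Require Import all_boot all_order all_algebra finmap.
From mathcomp Require Import all_classical all_reals all_analysis.
From mathcomp Require Import lra.

Set Implicit Arguments.
Unset Strict Implicit.
Unset Printing Implicit Defensive.

Import Order.TTheory GRing.Theory Num.Theory.
Import numFieldNormedType.Exports.

Local Open Scope classical_set_scope.
Local Open Scope ring_scope.

Section tuple_measure.
Local Open Scope ereal_scope.
Context d (T : measurableType d) (R : realType).
Variable m : {sigma_finite_measure set T -> \bar R}.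

Definition tcons n (z : T * n.-tuple T) : n.+1.-tuple T := [tuple of z.1 :: z.2].

Lemma measurable_tcons n : measurable_fun setT (@tcons n).
Proof. exact: measurable_cons. Qed.

Section step.
Variables (n : nat) (mu : {sigma_finite_measure set (n.-tuple T) -> \bar R}).

Definition tuple_measureS : set (n.+1.-tuple T) -> \bar R :=
  pushforward (m \x mu) (@tcons n).

Let mpre (A : set (n.+1.-tuple T)) :
  measurable A -> measurable (@tcons n @^-1` A).
Proof. by move=> mA; rewrite -[X in measurable X]setTI; exact: measurable_tcons. Qed.

Let tuple_measureS0 : tuple_measureS set0 = 0.
Proof. by rewrite /tuple_measureS /pushforward preimage_set0 measure0. Qed.

Let tuple_measureS_ge0 A : 0 <= tuple_measureS A.
Proof. by rewrite /tuple_measureS /pushforward measure_ge0. Qed.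

Let tuple_measureS_sigma_additive : semi_sigma_additive tuple_measureS.
Proof.
move=> F mF tF mUF; rewrite /tuple_measureS /pushforward preimage_bigcup.
apply: measure_semi_sigma_additive.
- by move=> k; exact: mpre.
- apply/trivIsetP => /= i j _ _ ij; rewrite -preimage_setI.
  by move/trivIsetP : tF => /(_ _ _ _ _ ij) ->//; rewrite preimage_set0.
- by rewrite -preimage_bigcup; exact: mpre.
Qed.

HB.instance Definition _ := isMeasure.Build _ _ _ tuple_measureS
  tuple_measureS0 tuple_measureS_ge0 tuple_measureS_sigma_additive.

Let tuple_measureS_sigma_finite : sigma_finite setT tuple_measureS.
Proof.
have /sigma_finiteP[F [TF ndF Foo]] := sigma_finiteT m.
have /sigma_finiteP[G [TG ndG Goo]] := sigma_finiteT mu.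
exists (fun k => [set x : n.+1.-tuple T |
    F k (thead x) /\ G k [tuple of behead x]]).
  apply/esym; rewrite -subTset => x _.
  have : setT (thead x) by [].
  rewrite TF => -[k _ Fk].
  have : setT [tuple of behead x] by [].
  rewrite TG => -[l _ Gl].
  exists (maxn k l) => //; split.
    by move: Fk; exact/subsetPset/ndF/leq_maxl.
  by move: Gl; exact/subsetPset/ndG/leq_maxr.
move=> k; have [mF Fk] := Foo k; have [mG Gk] := Goo k; split.
  rewrite (_ : [set _ | _] = (fun x : n.+1.-tuple T => thead x) @^-1` F k `&`
      (fun x : n.+1.-tuple T => [tuple of behead x]) @^-1` G k)//.
  apply: measurableI; rewrite -[X in measurable X]setTI.
    exact: measurable_tnth.
  exact: measurable_behead.
rewrite /tuple_measureS /pushforward (_ : _ @^-1` _ = F k `*` G k).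
  by rewrite product_measure1E// lte_mul_pinfty// ge0_fin_numE.
have beheadK (z : T * n.-tuple T) : [tuple of behead (tcons z)] = z.2 :> n.-tuple T.
  exact/val_inj.
by apply/seteqP; split => z /=; rewrite beheadK theadE.
Qed.

HB.instance Definition _ := Measure_isSigmaFinite.Build _ _ _ tuple_measureS
  tuple_measureS_sigma_finite.

End step.

Fixpoint tuple_measure n : {sigma_finite_measure set (n.-tuple T) -> \bar R} :=
  if n is n'.+1 then tuple_measureS (tuple_measure n') else \d_[tuple].

Lemma measurable_box n (A : 'I_n -> set T) : (forall i, measurable (A i)) ->
  measurable [set x : n.-tuple T | forall i, A i (tnth x i)].
Proof.
move=> mA; rewrite (_ : [set _ | _] =
    \bigcap_(i in [set: 'I_n]) ((@tnth n T)^~ i @^-1` A i)).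
  apply: fin_bigcap_measurable => // i _.
  by rewrite -[X in measurable X]setTI; exact: measurable_tnth.
by apply/seteqP; split => [x Ax i _|x Ax i]; exact: Ax.
Qed.

Lemma tuple_measure_box n (A : 'I_n -> set T) : (forall i, measurable (A i)) ->
  tuple_measure n [set x | forall i, A i (tnth x i)] = \prod_(i < n) m (A i).
Proof.
elim: n A => [|n IH] A mA; first by rewrite big_ord0 /= diracE mem_set// => -[].
rewrite big_ord_recl /= -IH//.
have mbox := measurable_box (fun i => mA (lift ord0 i)).
rewrite -product_measure1E// /tuple_measureS /pushforward; congr (_ _).
apply/seteqP; split => [[x y]/= Axy|[x y]/= [Ax Ay] i].
  by split => [|i]; [have := Axy ord0|have := Axy (lift ord0 i); rewrite tnthS].
by have [j ->|->] := unliftP ord0 i; rewrite ?tnthS.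
Qed.

End tuple_measure.

Section lebesgue_tuple.
Context (R : realType) (n : nat).

(* The Borel product measure is completed, so that integrability with respect
   to [lebesgue_tuple] is Lebesgue (not just Borel) integrability on R^n. *)
Definition lebesgue_tuple :=
  @completed_measure_extension _ _ _ (tuple_measure (@lebesgue_measure R) n).

HB.instance Definition _ := Measure.on lebesgue_tuple.

Lemma lebesgue_tuple_box (A : 'I_n -> set (measurableTypeR R)) :
  (forall i, measurable (A i)) ->
  lebesgue_tuple [set x | forall i, A i (tnth x i)] =
  (\prod_(i < n) lebesgue_measure (A i))%E.
Proof.
move=> mA; rewrite -tuple_measure_box//.
apply: measurable_mu_extE; exact: measurable_box.
Qed.

Definition cube : set (n.-tuple R) := [set x | forall j, 0 <= tnth x j <= 1].

Definition cube_integrable (f : n.-tuple R -> R) :=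
  lebesgue_tuple.-integrable cube (EFin \o f).

Definition cube_integral (f : n.-tuple R -> R) : R :=
  \int[lebesgue_tuple]_(x in cube) f x.

End lebesgue_tuple.

(* The i-th binary digit of n, of weight 2 ^ i. *)
Definition bit (n i : nat) : bool := odd (n %/ 2 ^ i).

Definition bitvec q (n : nat) : 'cV['F_2]_q := \col_(i < q) (bit n i)%:R.

Section binary_digits.
Context (R : realType).

Definition binary_value (xi : nat -> bool) : R :=
  limn (series (fun r => (xi r)%:R / 2 ^+ r.+1 : R)).

(* 0-based: [binary_digit x r] is the digit of weight 2^-(r+1) in the standard
   binary expansion of x in [0, 1), see [binary_digitK] and [binary_valueK];
   for x = 1 all the digits are 0. *)
Definition binary_digit (x : R) (r : nat) : bool :=
  odd (Num.truncn (2 ^+ r.+1 * x)).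

Definition not_eventually_one (xi : nat -> bool) :=
  forall r0, exists2 r, (r0 <= r)%N & ~~ xi r.

Let ps (xi : nat -> bool) : R^nat := series (fun r => (xi r)%:R / 2 ^+ r.+1).

Let half_exp n : 2 ^- n = 2 * 2 ^- n.+1 :> R.
Proof. by rewrite exprS invfM mulrA divff ?mul1r// pnatr_eq0. Qed.

Let psS xi n : ps xi n.+1 = ps xi n + (xi n)%:R / 2 ^+ n.+1.
Proof. by rewrite /ps /series/= big_nat_recr. Qed.

Let ps_ndecr xi : {homo ps xi : n k / (n <= k)%N >-> n <= k}.
Proof.
by apply: homo_leq => // [|n]; [exact: le_trans|rewrite psS lerDl divr_ge0].
Qed.

Let ps_tail xi : {homo (fun n => - (ps xi n + 2 ^- n)) : n k / (n <= k)%N >-> n <= k}.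
Proof.
apply: homo_leq => // [|n]; first exact: le_trans.
rewrite lerN2 psS (half_exp n) -addrA lerD2l mulrDl mul1r lerD2r.
by rewrite ler_piMl ?invr_ge0// lern1 leq_b1.
Qed.

Let cvg_ps xi : ps xi @ \oo --> binary_value xi.
Proof.
apply: nondecreasing_is_cvgn => //.
exists 1 => _ [n _ <-].
have := ps_tail xi (leq0n n); rewrite lerN2 expr0 invr1.
rewrite [ps xi 0]big_geq// add0r; apply: le_trans.
by rewrite lerDl invr_ge0 exprn_ge0.
Qed.

Let ps_le xi n : ps xi n <= binary_value xi.
Proof. by apply: nondecreasing_cvgn_le => //; apply/cvg_ex; eexists; exact: cvg_ps. Qed.

Let ps_ge xi n : binary_value xi <= ps xi n + 2 ^- n.
Proof.
apply: limr_le; first by apply/cvg_ex; eexists; exact: cvg_ps.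
near=> k; apply: (@le_trans _ _ (ps xi k + 2 ^- k)).
  by rewrite lerDl invr_ge0 exprn_ge0.
by rewrite -lerN2; apply: ps_tail; near: k; exact: nbhs_infty_ge.
Unshelve. all: by end_near. Qed.

Let ps_gt xi n : not_eventually_one xi -> binary_value xi < ps xi n + 2 ^- n.
Proof.
move=> /(_ n)[r nr /negbTE xir]; apply: (le_lt_trans (ps_ge xi r.+1)).
rewrite psS xir mul0r addr0.
apply: (@lt_le_trans _ _ (ps xi r + 2 ^- r)); last by rewrite -lerN2; exact: ps_tail.
by rewrite ltrD2l (half_exp r) mulrDl mul1r ltrDl invr_gt0 exprn_gt0.
Qed.

Fixpoint leading (xi : nat -> bool) n : nat :=
  if n is n'.+1 then (xi n' + (leading xi n').*2)%N else 0%N.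

Let psE xi n : ps xi n = (leading xi n)%:R / 2 ^+ n.
Proof.
elim: n => [|n IH]; first by rewrite [LHS]big_geq// mul0r.
rewrite psS IH /= natrD mulrDl addrC -muln2 natrM; congr (_ + _).
by rewrite (half_exp n) mulrA.
Qed.

Lemma truncn_binary_value xi n : not_eventually_one xi ->
  Num.truncn (2 ^+ n * binary_value xi) = leading xi n.
Proof.
move=> xi1; apply: truncn_def.
have e0 : 0 < 2 ^+ n :> R by rewrite exprn_gt0.
have := ps_le xi n; have := ps_gt n xi1; rewrite psE -[X in _ < _ + X]mul1r -mulrDl.
by rewrite ltr_pdivlMr// ler_pdivrMr// natr1 [2 ^+ n * _]mulrC => -> ->.
Qed.

Lemma binary_valueK xi : not_eventually_one xi ->
  forall r, binary_digit (binary_value xi) r = xi r.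
Proof.
move=> xi1 r; rewrite /binary_digit truncn_binary_value//=.
by rewrite oddD odd_double addbF oddb.
Qed.

Lemma binary_value_itv xi : not_eventually_one xi -> 0 <= binary_value xi < 1.
Proof.
move=> xi1; have := ps_le xi 0; have := ps_gt 0 xi1.
by rewrite [ps xi 0]big_geq// add0r expr0 invr1 => -> ->.
Qed.

Let leading_digit x n : 0 <= x < 1 ->
  leading (binary_digit x) n = Num.truncn (2 ^+ n * x).
Proof.
move=> /andP[x0 x1]; elim: n => [|n IH].
  by rewrite mul1r; apply/esym/truncn_def; rewrite x0.
have e0 k : 0 <= 2 ^+ k * x by rewrite mulr_ge0// exprn_ge0.
rewrite /= IH /binary_digit; set t := Num.truncn _; set t' := Num.truncn _.
suff -> : t' = t./2 by rewrite odd_double_half.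
have := truncn_itv (e0 n.+1); have := truncn_itv (e0 n).
rewrite -/t -/t' [in X in _ -> X -> _]exprS -mulrA => /andP[a' b'] /andP[a b].
have h1 : (t'.*2 <= t)%N.
  by rewrite truncn_ge_nat// -muln2 natrM mulrC exprS -mulrA ler_pM2l.
have h2 : (t < t'.+1.*2)%N.
  by rewrite truncn_lt_nat// -muln2 natrM [_ * 2%:R]mulrC exprS -mulrA ltr_pM2l.
by apply/eqP; rewrite eqn_leq -{1}(doubleK t') half_leq//= -ltnS -(doubleK t'.+1) ltn_half_double doubleK.
Qed.

Let digit_bounds x n : 0 <= x < 1 ->
  ps (binary_digit x) n <= x < ps (binary_digit x) n + 2 ^- n.
Proof.
move=> x01; have /andP[x0 _] := x01; rewrite psE leading_digit//.
have e0 : 0 < 2 ^+ n :> R by rewrite exprn_gt0.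
rewrite -[X in _ + X]mul1r -mulrDl ltr_pdivlMr// ler_pdivrMr// natr1 [x * _]mulrC.
by apply: truncn_itv; rewrite mulr_ge0// ltW.
Qed.

Let small_exp (e : R) : 0 < e -> exists n, 2 ^- n < e.
Proof.
move=> e0; exists (Num.bound e^-1).
rewrite invf_plt ?posrE ?exprn_gt0//.
apply: (lt_trans (archi_boundP _)); first by rewrite invr_ge0 ltW.
by rewrite -natrX ltr_nat ltn_expl.
Qed.

Lemma binary_digitK x : 0 <= x < 1 -> binary_value (binary_digit x) = x.
Proof.
move=> x01; apply/eqP; apply: contraT => ne.
have : 0 < `|binary_value (binary_digit x) - x| by rewrite normr_gt0 subr_eq0.
move=> /small_exp[n]; rewrite ltNge => /negP; case.
have /andP[a b] := digit_bounds n x01.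
have := ps_le (binary_digit x) n; have := ps_ge (binary_digit x) n.
by move=> c d'; rewrite ler_norml; apply/andP; split; lra.
Qed.

Lemma binary_digit_not_one x : 0 <= x < 1 -> not_eventually_one (binary_digit x).
Proof.
move=> x01 n; apply: contrapT => H.
have xi1 r : (n <= r)%N -> binary_digit x r.
  by move=> nr; apply: contrapT => /negP ?; apply: H; exists r.
have /andP[_ b] := digit_bounds n x01.
have [k] : exists k, 2 ^- k < ps (binary_digit x) n + 2 ^- n - x.
  by apply: small_exp; rewrite subr_gt0.
have E j : ps (binary_digit x) (n + j)%N + 2 ^- (n + j) = ps (binary_digit x) n + 2 ^- n.
  elim: j => [|j IH]; first by rewrite addn0.
  by rewrite addnS psS xi1 ?leq_addr// -IH [2 ^- (n + j)]half_exp /= mul1r -addrA -mulr2n mulr_natl.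
have /andP[a _] := digit_bounds (n + k) x01.
rewrite -(E k) => Ek.
have : 2 ^- (n + k) <= 2 ^- k :> R.
  by rewrite lef_pV2 ?posrE ?exprn_gt0// ler_eXn2l ?ltr1n// leq_addl.
lra.
Qed.

End binary_digits.

Section walsh.
Context (R : realType).

(* k < 2 ^ k, so all the nonzero bits of k have index < k. *)
Definition wal (k : nat) (x : R) : R :=
  (-1) ^+ (\sum_(i < k) bit k i * binary_digit x i).

Definition walt d (k : {ffun 'I_d -> nat}) (x : d.-tuple R) : R :=
  \prod_(j < d) wal (k j) (tnth x j).

Definition walsh_coef d (F : d.-tuple R -> R) (k : {ffun 'I_d -> nat}) : R :=
  cube_integral (fun x => F x * walt k x).

End walsh.

Section digital_net.
Context (d m : nat) (C : 'I_d -> nat -> 'rV['F_2]_m).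

(* Row r (0-based) of C j yields the digit of weight 2^-(r+1). *)
Definition net_digit (n : nat) (j : 'I_d) (r : nat) : 'F_2 :=
  (C j r *m bitvec m n) ord0 ord0.

Definition net_bits (n : nat) (j : 'I_d) (r : nat) : bool := net_digit n j r != 0.

Definition net_point (R : realType) (n : nat) : d.-tuple R :=
  [tuple binary_value R (net_bits n j) | j < d].

Definition trunc_gen (p : nat) (j : 'I_d) : 'M['F_2]_(p, m) :=
  \matrix_(r < p) C j r.

Definition retained_dual (p : nat) : pred {ffun 'I_d -> nat} :=
  [pred h : {ffun 'I_d -> nat} | [forall j, h j < 2 ^ p]%N &&
    (\sum_(j < d) (trunc_gen p j)^T *m bitvec p (h j) == 0)].

End digital_net.

(* k = low_part p k + 2 ^ p * (k %/ 2 ^ p), coordinatewise *)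
Definition low_part d (p : nat) (k : {ffun 'I_d -> nat}) : {ffun 'I_d -> nat} :=
  [ffun j => (k j %% 2 ^ p)%N].

Section rules.
Context (R : realType) (d p : nat) (c : nat -> R).

Definition rule_index (x : R) : nat := Num.truncn (2 ^+ p * x).

Definition rule (x : R) : R := c (rule_index x).

Definition Qnet m (C : 'I_d -> nat -> 'rV['F_2]_m) (f : d.-tuple R -> R) : R :=
  (2 ^ m)%:R^-1 * \sum_(n < 2 ^ m) f (map_tuple rule (net_point C R n)).

Definition Qprod (f : d.-tuple R -> R) : R :=
  (2 ^ (p * d))%:R^-1 *
  \sum_(a : {ffun 'I_d -> 'I_(2 ^ p)}) f [tuple c (a j) | j < d].

Definition transformed (phi : R -> R) (f : d.-tuple R -> R) (x : d.-tuple R) : R :=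
  f (map_tuple phi x).

Definition grid_point (a : {ffun 'I_d -> 'I_(2 ^ p)}) : d.-tuple R :=
  [tuple (a j)%:R / 2 ^+ p | j < d].

End rules.

Section exhaustion_sums.
Context (R : realType) (d : nat) (K : nat -> {fset {ffun 'I_d -> nat}}).
Variables (S : pred {ffun 'I_d -> nat}) (u : {ffun 'I_d -> nat} -> R).

Definition exhaustion : Prop :=
  {homo K : s t / (s <= t)%N >-> (s `<=` t)%fset} /\
  forall k, exists s, k \in K s.

Definition Kpartial : R^nat := fun s => \sum_(k <- K s | S k) u k.

(* [limn] is only meaningful when the limit exists: statements about [Ksum]
   should come with [cvgn Kpartial]. *)
Definition Ksum : R := limn Kpartial.

End exhaustion_sums.

(* Main.v *)
(* At a resolution-p grid point a / 2^p the Walsh function wal_k only sees the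
   low part of k, and equals an additive character of F_2 evaluated at a linear
   form in the digits of a.  Averaged over the net (resp. over the whole grid),
   orthogonality of characters gives 1 when the low part of k lies in the
   retained dual set (resp. vanishes) and 0 otherwise, and these finite averages
   commute with the limit defining the termwise sum. *)
Require Import Defs.
From mathcomp Require Import all_boot all_order all_algebra finmap.
From mathcomp Require Import all_classical all_reals all_analysis.

Set Implicit Arguments.
Unset Strict Implicit.
Unset Printing Implicit Defensive.

Import Order.TTheory GRing.Theory Num.Theory.
Import numFieldNormedType.Exports.

Local Open Scope classical_set_scope.
Local Open Scope ring_scope.

(** * Binary digits of natural numbers and of digit sequences *)

Lemma bit0n i : bit 0 i = false.
Proof. by rewrite /bit div0n. Qed.

Lemma bitS n i : bit n i.+1 = bit n./2 i.
Proof. by rewrite /bit expnS divnMA divn2. Qed.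

Lemma bit_modn n p i : (i < p)%N -> bit (n %% 2 ^ p) i = bit n i.
Proof.
elim: i p n => [|i IH] [|p] n // ip.
  by rewrite /bit expn0 !divn1 odd_mod// expnS oddM.
by rewrite !bitS -!divn2 expnSr -modn_divl IH.
Qed.

Lemma bit_ge n i : (n <= i)%N -> bit n i = false.
Proof.
by move=> ni; rewrite /bit divn_small// (leq_ltn_trans ni)// ltn_expl.
Qed.

Lemma bit_inj p a b : (a < 2 ^ p)%N -> (b < 2 ^ p)%N ->
  (forall i, (i < p)%N -> bit a i = bit b i) -> a = b.
Proof.
elim: p a b => [|p IH] a b; first by rewrite !ltnS !leqn0 => /eqP-> /eqP->.
rewrite expnS mul2n => ha hb ab.
rewrite -(odd_double_half a) -(odd_double_half b).
have := ab 0 isT; rewrite /bit expn0 !divn1 => ->.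
congr (_ + _.*2)%N; apply: IH => [||i ip]; rewrite ?ltn_half_double//.
by rewrite -!bitS ab.
Qed.

(** Numbers below [2 ^ m] are determined by their first m bits, and both sides have [2 ^ m]
    elements. This turns sums over point indices into sums over the whole space of column
    vectors. *)
Lemma bitvec_bij m : bijective (fun n : 'I_(2 ^ m) => bitvec m n).
Proof.
apply: inj_card_bij; last by rewrite card_mx card_Fp// muln1 card_ord.
move=> a b ab; apply: val_inj; apply: (@bit_inj m) => //= i im.
have /matrixP/(_ (Ordinal im) ord0) := ab; rewrite !mxE /=.
by case: (bit a i); case: (bit b i).
Qed.

Lemma bitvec_modn p n : bitvec p (n %% 2 ^ p) = bitvec p n.
Proof. by apply/matrixP => i j; rewrite !mxE bit_modn. Qed.

Lemma bitvec_eq0 p n : (bitvec p n == 0) = (n %% 2 ^ p == 0)%N.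
Proof.
apply/eqP/eqP => [n0|n0]; last first.
  by rewrite -bitvec_modn n0; apply/matrixP => i j; rewrite !mxE bit0n.
apply: (@bit_inj p) => [||i ip]; rewrite ?ltn_pmod ?expn_gt0//.
have /matrixP/(_ (Ordinal ip) ord0) := n0.
by rewrite !mxE /= bit_modn// bit0n; case: (bit n i).
Qed.

Lemma leading_lt xi p : (leading xi p < 2 ^ p)%N.
Proof.
elim: p => //= p IH; rewrite expnS mul2n.
by case: (xi p); rewrite ?add0n ?ltn_double// add1n ltn_Sdouble.
Qed.

(** [leading] puts the first digit in the most significant place; this is the source of the index
    reversal [p.-1 - i] below. *)
Lemma bit_leading xi p i : (i < p)%N -> bit (leading xi p) (p.-1 - i) = xi i.
Proof.
elim: p => // p IH; rewrite ltnS leq_eqVlt => /predU1P[->|ip] /=.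
  by rewrite subnn /bit expn0 divn1 oddD odd_double addbF oddb.
have -> : (p - i = (p.-1 - i).+1)%N by case: p ip {IH} => // p ip; rewrite subSn.
by rewrite bitS half_bit_double IH.
Qed.

Lemma F2_boolE (x : 'F_2) : (x != 0)%:R = x.
Proof. by case: x => -[|[|]]// ?; apply: val_inj. Qed.

(** * Characters of F_2 and their orthogonality *)

Section characters.
Context (R : realType).

(** The nontrivial additive character of F_2. *)
Definition chi (x : 'F_2) : R := (-1) ^+ (x != 0)%R.

Lemma chi0 : chi 0 = 1.
Proof. by rewrite /chi eqxx. Qed.

Lemma chiD : {morph chi : x y / x + y >-> x * y}.
Proof.
move=> x y; rewrite -(F2_boolE x) -(F2_boolE y) /chi.
by case: (x != 0); case: (y != 0); rewrite /= ?mulr1 ?mul1r// ?mulrNN ?mulr1.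
Qed.

Lemma chi_sum I r (P : pred I) F :
  chi (\sum_(i <- r | P i) F i) = \prod_(i <- r | P i) chi (F i).
Proof. by rewrite (big_morph _ chiD chi0). Qed.

Lemma chi_nat n : chi n%:R = (-1) ^+ n.
Proof. by elim: n => [|n IH]; rewrite ?chi0// -natr1 chiD IH exprSr. Qed.

(* For w != 0, translating v by a unit vector on which w is nonzero flips the
   sign of the sum. *)
Lemma sum_chi m (w : 'rV['F_2]_m) :
  \sum_(v : 'cV['F_2]_m) chi ((w *m v) ord0 ord0) =
  if w == 0 then (2 ^ m)%:R else 0.
Proof.
case: eqP => [->|/eqP w0].
  under eq_bigr do rewrite mul0mx mxE chi0.
  by rewrite sumr_const card_mx card_Fp// muln1.
have [i wi] : exists i, w ord0 i != 0.
  apply/existsP; apply: contraNT w0; rewrite negb_exists => /forallP wN.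
  by apply/eqP/rowP => i; rewrite mxE; apply/eqP; rewrite -[_ == _]negbK wN.
apply/eqP; rewrite -eqNr; apply/eqP.
rewrite [RHS](reindex_inj (addrI (delta_mx i ord0))) -sumrN.
apply: eq_bigr => v _; rewrite mulmxDr -colE !mxE chiD.
by rewrite [X in _ = X * _]/chi wi expr1 mulN1r.
Qed.

Lemma sum_chi_bitvec m (w : 'rV['F_2]_m) :
  \sum_(n < 2 ^ m) chi ((w *m bitvec m n) ord0 ord0) =
  if w == 0 then (2 ^ m)%:R else 0.
Proof.
by rewrite -sum_chi [RHS](reindex _ (onW_bij _ (bitvec_bij m))).
Qed.

End characters.

(** * Walsh functions on the resolution-p grid *)

Section grid.
Context (R : realType) (p : nat).

Lemma binary_digit_grid (a i : nat) :
  binary_digit (a%:R / 2 ^+ p : R) i = (i < p)%N && bit a (p.-1 - i).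
Proof.
have e0 n : 0 < 2 ^+ n :> R by rewrite exprn_gt0.
rewrite /binary_digit; case: ltnP => ip /=.
  have -> : (p.-1 - i = p - i.+1)%N by case: p ip => // q _; rewrite subSS.
  rewrite /bit; congr odd; apply: truncn_def.
  have -> : 2 ^+ i.+1 * (a%:R / 2 ^+ p) = a%:R / (2 ^ (p - i.+1))%:R :> R.
    rewrite -{1}(subnK ip) exprD natrX invfM mulrCA; congr (_ * _).
    by rewrite mulrCA divff ?mulr1// gt_eqF.
  rewrite ler_pdivlMr ?ltr_pdivrMr ?ltr0n ?expn_gt0// -!natrM ler_nat ltr_nat.
  by rewrite leq_divM ltn_ceil// expn_gt0.
(* Past position p the scaled number is an integer, and it is even because [i.+1 - p] is positive,
   so the digit is 0. *)
have -> : 2 ^+ i.+1 * (a%:R / 2 ^+ p) = (2 ^ (i.+1 - p) * a)%:R :> R.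
  rewrite -{1}(subnK (leqW ip)) exprD natrM natrX -mulrA; congr (_ * _).
  by rewrite mulrCA divff ?mulr1// gt_eqF.
by rewrite natrK oddM subSn// oddX.
Qed.

Lemma wal_grid (k a : nat) :
  wal k (a%:R / 2 ^+ p : R) =
  chi R (\sum_(i < p) (bit k i)%:R * (bit a (p.-1 - i))%:R).
Proof.
(* [wal] sums over i < k and the character over i < p. The common summand [F] vanishes from k on and
   from p on, so both sums equal the one over i < k + p. *)
pose F i := (bit k i * ((i < p)%N && bit a (p.-1 - i)))%N.
have cut n q : (forall i, (n <= i)%N -> F i = 0%N) ->
    (\sum_(i < n + q) F i = \sum_(i < n) F i)%N.
  move=> F0; rewrite big_split_ord /= [X in (_ + X)%N]big1 ?addn0// => i _.
  by rewrite F0// leq_addr.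
have -> : \sum_(i < p) (bit k i)%:R * (bit a (p.-1 - i))%:R
    = (\sum_(i < p) F i)%N%:R :> 'F_2.
  by rewrite natr_sum; apply: eq_bigr => i _; rewrite /F ltn_ord natrM.
rewrite chi_nat /wal; congr (_ ^+ _).
under eq_bigr do rewrite binary_digit_grid.
rewrite -(cut k p) => [|i ki]; last by rewrite /F bit_ge.
by rewrite addnC (cut p k)// => i pi; rewrite /F ltnNge pi muln0.
Qed.

Lemma walt_grid d (k : {ffun 'I_d -> nat}) (a : {ffun 'I_d -> 'I_(2 ^ p)}) :
  walt k (grid_point R a) = \prod_(j < d)
    chi R (\sum_(i < p) (bit (k j) i)%:R * (bit (a j) (p.-1 - i))%:R).
Proof. by apply: eq_bigr => j _; rewrite tnth_mktuple wal_grid. Qed.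

Lemma sum_walt_grid d (k : {ffun 'I_d -> nat}) :
  \sum_(a : {ffun 'I_d -> 'I_(2 ^ p)}) walt k (grid_point R a) =
  if low_part p k == [ffun => 0%N] then (2 ^ (p * d))%:R else 0.
Proof.
under eq_bigr do rewrite walt_grid.
(* The sum over the product grid factors into d one-dimensional sums, each a character sum; a single
   nonzero low part makes the product vanish. *)
rewrite -(bigA_distr_bigA (fun j (a : 'I_(2 ^ p)) =>
  chi R (\sum_(i < p) (bit (k j) i)%:R * (bit a (p.-1 - i))%:R))) /=.
have sum1 h : \sum_(a < 2 ^ p)
      chi R (\sum_(i < p) (bit h i)%:R * (bit a (p.-1 - i))%:R) =
    if (h %% 2 ^ p == 0)%N then (2 ^ p)%:R else 0.
  (* Reversing the digits of h instead of those of a makes the exponent the linear form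
     [w *m bitvec p a]. *)
  pose w : 'rV['F_2]_p := \row_i bitvec p h (rev_ord i) ord0.
  have -> : (h %% 2 ^ p == 0)%N = (w == 0).
    rewrite -bitvec_eq0; apply/eqP/eqP => [h0|w0].
      by apply/rowP => i; rewrite mxE h0 !mxE.
    apply/colP => i; have /rowP/(_ (rev_ord i)) := w0.
    by rewrite !mxE rev_ordK.
  rewrite -sum_chi_bitvec; apply: eq_bigr => a _; congr (chi R _).
  rewrite mxE (reindex_inj rev_ord_inj); apply: eq_bigr => i _.
  rewrite !mxE; congr (_ * (bit a _)%:R).
  by rewrite /= -subn1 -subnDA add1n -subSn// subSS subKn// ltnW.
under eq_bigr do rewrite sum1.
case: eqP => [k0|/eqP k0].
  rewrite (eq_bigr (fun=> (2 ^ p)%:R)) => [|j _].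
    by rewrite prodr_const card_ord -natrX -expnM.
  by have /ffunP/(_ j) := k0; rewrite !ffunE => ->.
have [j kj] : exists j, (k j %% 2 ^ p != 0)%N.
  apply/existsP; apply: contraNT k0; rewrite negb_exists => /forallP kN.
  by apply/eqP/ffunP => j; rewrite !ffunE; apply/eqP; rewrite -[_ == _]negbK kN.
by rewrite (bigD1 j)//= (negbTE kj) mul0r.
Qed.

End grid.

(** * Truncated net points and the retained dual set *)

Lemma low_part_retained_dual d m (C : 'I_d -> nat -> 'rV['F_2]_m) p
    (k : {ffun 'I_d -> nat}) :
  (low_part p k \in retained_dual C p) =
  (\sum_(j < d) (trunc_gen C p j)^T *m bitvec p (k j) == 0).
Proof.
rewrite inE (_ : [forall j, _]); last first.
  by apply/forallP => j; rewrite ffunE ltn_pmod// expn_gt0.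
by under eq_bigr do rewrite ffunE bitvec_modn.
Qed.

Section net.
Context (R : realType) (d m p : nat) (C : 'I_d -> nat -> 'rV['F_2]_m).

(** Numerators of the net point truncated to p digits. The Walsh expansion is evaluated at this grid
    corner, where termwise convergence is assumed, and not at the net point itself. *)
Definition net_index (n : nat) : {ffun 'I_d -> 'I_(2 ^ p)} :=
  [ffun j => Ordinal (leading_lt (net_bits C n j) p)].

(** The reversals in [walt_grid] and [leading] cancel, so bit i of [k j] meets row i of [C j]
    applied to the digits of n; transposition gathers the generating matrices on the side of k. *)
Lemma walt_net_index (k : {ffun 'I_d -> nat}) n :
  walt k (grid_point R (net_index n)) =
  chi R (((\sum_(j < d) (trunc_gen C p j)^T *m bitvec p (k j))^T
          *m bitvec m n) ord0 ord0).
Proof.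
rewrite walt_grid -chi_sum; congr (chi R _).
rewrite raddf_sum mulmx_suml summxE; apply: eq_bigr => j _.
rewrite /= trmx_mul trmxK -mulmxA mxE; apply: eq_bigr => i _.
rewrite ffunE /= bit_leading// /net_bits F2_boolE !mxE; congr (_ * _).
by rewrite /net_digit mxE; apply: eq_bigr => l _; rewrite !mxE.
Qed.

Lemma sum_walt_net (k : {ffun 'I_d -> nat}) :
  \sum_(n < 2 ^ m) walt k (grid_point R (net_index n)) =
  if low_part p k \in retained_dual C p then (2 ^ m)%:R else 0.
Proof.
under eq_bigr do rewrite walt_net_index.
by rewrite sum_chi_bitvec low_part_retained_dual trmx_eq0.
Qed.

(** Excluding digit sequences ending in ones is what makes the floor of [2 ^+ p * x] the number
    formed by the first p digits; such a tail could carry it up by one. *)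
Lemma rule_net_point (c : nat -> R) n :
  (forall j, not_eventually_one (net_bits C n j)) ->
  map_tuple (rule p c) (net_point C R n) =
  [tuple c (net_index n j) | j < d].
Proof.
move=> n1; apply: eq_from_tnth => j; rewrite tnth_map !tnth_mktuple ffunE /=.
by rewrite /rule /rule_index truncn_binary_value.
Qed.

End net.

Lemma transformed_grid_point (R : realType) d p (c : nat -> R) (phi : R -> R)
    (f : d.-tuple R -> R) (a : {ffun 'I_d -> 'I_(2 ^ p)}) :
  (forall b, (b < 2 ^ p)%N -> phi (b%:R / 2 ^+ p) = c b) ->
  transformed phi f (grid_point R a) = f [tuple c (a j) | j < d].
Proof.
move=> phic; congr f; apply: eq_from_tnth => j.
by rewrite tnth_map !tnth_mktuple phic.
Qed.

(** * Averages of termwise sums *)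

Section termwise.
Context (R : realType) (d : nat) (K : nat -> {fset {ffun 'I_d -> nat}}).
Variable u : {ffun 'I_d -> nat} -> R.

(* Averaging finitely many termwise convergent expansions, when the averages
   of the characters form the indicator of S, leaves the sum over S. *)
Lemma cvg_Kpartial_average (I : finType) (N : nat)
    (w : I -> {ffun 'I_d -> nat} -> R) (l : I -> R)
    (S : pred {ffun 'I_d -> nat}) : (0 < N)%N ->
  (forall k, \sum_i w i k = if S k then N%:R else 0) ->
  (forall i, Kpartial K predT (fun k => u k * w i k) @ \oo --> l i) ->
  Kpartial K S u @ \oo --> N%:R^-1 * \sum_i l i.
Proof.
move=> N0 sumw cvgl.
rewrite (_ : Kpartial K S u = fun s => N%:R^-1 *
    \sum_i Kpartial K predT (fun k => u k * w i k) s).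
  apply: cvgM; first exact: cvg_cst.
  apply: cvg_big => [|i _]; last exact: cvgl.
  exact: add_continuous.
apply/funext => s; rewrite /Kpartial exchange_big mulr_sumr big_mkcond.
apply: eq_bigr => k _; rewrite -mulr_sumr sumw.
case: (S k); last by rewrite !mulr0.
by rewrite mulrCA mulVf ?mulr1// pnatr_eq0 -lt0n.
Qed.

End termwise.

Theorem theorem4p1 (R : realType) (d m p : nat)
  (C : 'I_d -> nat -> 'rV['F_2]_m)
  (hC : forall (n : 'I_(2 ^ m)) (j : 'I_d), not_eventually_one (net_bits C n j))
  (hp : (1 <= p)%N)
  (c : nat -> R)
  (hc : forall a : nat, (a < 2 ^ p)%N -> 0 <= c a <= 1)
  (phi : R -> R)
  (hphi01 : forall x : R, 0 <= x <= 1 -> 0 <= phi x <= 1)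
  (hphi_mono : {in `[0, 1] &, {homo phi : x y / x <= y}})
  (hphi_c : forall a : nat, (a < 2 ^ p)%N -> phi (a%:R / 2 ^+ p) = c a)
  (f : d.-tuple R -> R)
  (hf : cube_integrable f)
  (hFp_int : cube_integrable (transformed phi f))
  (K : nat -> {fset {ffun 'I_d -> nat}})
  (hK : exhaustion K)
  (hwalsh : forall a : {ffun 'I_d -> 'I_(2 ^ p)},
    Kpartial K predT
        (fun k => walsh_coef (transformed phi f) k * walt k (grid_point R a))
      @ \oo --> transformed phi f (grid_point R a)) :
  let Dp := retained_dual C p in
  let zero := [ffun => 0%N] : {ffun 'I_d -> nat} in
  let Snet := [pred k | low_part p k \in Dp] in
  let Sprod := [pred k | low_part p k == zero] in
  let Stail := [pred k | (low_part p k \in Dp) && (low_part p k != zero)] in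
  let Fhat := walsh_coef (transformed phi f) in
  let I := cube_integral f in
  [/\ cvgn (Kpartial K Snet Fhat) /\ Qnet p c C f = Ksum K Snet Fhat,
      cvgn (Kpartial K Sprod Fhat) /\ Qprod p c f = Ksum K Sprod Fhat
    & cvgn (Kpartial K Stail Fhat) /\
      Qnet p c C f - I = (Qprod p c f - I) + Ksum K Stail Fhat].
Proof.
move=> Dp zero Snet Sprod Stail Fhat I.
(* The expansions are averaged over the corners [net_index n], at which [transformed phi f] takes
   the values that the rule samples. *)
have net : Kpartial K Snet Fhat @ \oo --> Qnet p c C f.
  rewrite /Qnet; under eq_bigr do rewrite rule_net_point//.
  apply: cvg_Kpartial_average (sum_walt_net R p C) _; first by rewrite expn_gt0.
  by move=> n; rewrite -(transformed_grid_point f _ hphi_c); exact: hwalsh.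
have prod : Kpartial K Sprod Fhat @ \oo --> Qprod p c f.
  apply: cvg_Kpartial_average (@sum_walt_grid R p d) _; first by rewrite expn_gt0.
  by move=> a; rewrite -(transformed_grid_point f _ hphi_c); exact: hwalsh.
(* This makes [Sprod] a subset of [Snet], with [Stail] as the difference. *)
have zeroD : zero \in Dp.
  rewrite inE; apply/andP; split.
    by apply/forallP => j; rewrite ffunE expn_gt0.
  rewrite big1// => j _; rewrite ffunE.
  by rewrite (_ : bitvec p 0 = 0) ?mulmx0//; apply/eqP; rewrite bitvec_eq0 mod0n.
(* The subtraction is made on the finite partial sums, so convergence of the tail follows from that
   of the other two. *)
have tail : Kpartial K Stail Fhat @ \oo --> Qnet p c C f - Qprod p c f.
  rewrite (_ : Kpartial K Stail Fhat =
    Kpartial K Snet Fhat \- Kpartial K Sprod Fhat); first exact: cvgB.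
  apply/funext => s /=; apply/eqP; rewrite eq_sym subr_eq addrC; apply/eqP.
  rewrite /Kpartial (bigID Sprod); congr (_ + _); apply: eq_bigl => k //=.
  by rewrite andb_idl// => /eqP ->.
split; (split; first by apply/cvg_ex; eexists; eassumption).
- by rewrite /Ksum (cvg_lim _ net).
- by rewrite /Ksum (cvg_lim _ prod).
- by rewrite /Ksum (cvg_lim _ tail)// [RHS]addrC addrA subrK.
Qed.
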